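(* For integers $m,n\ge 1$, let $\mathrm{Knight}_{m,n}$ be the $m\times n$ knight graph and let $\mathcal{R}$ denote the representation number. Then $\mathcal{R}(\mathrm{Knight}_{m,n})$ is finite for all $m,n\ge 1$, and: \begin{itemize} \item $\mathcal{R}(\mathrm{Knight}_{1,1})=1$ and $\mathcal{R}(\mathrm{Knight}_{1,n})=2$ for all $n\ge 2$; \item $\mathcal{R}(\mathrm{Knight}_{2,n})=2$ for all $n\ge 1$; \item $\mathcal{R}(\mathrm{Knight}_{3,n})=2$ for $n\in\{1,2,3,4\}$, and $\mathcal{R}(\mathrm{Knight}_{3,n})\ge 3$ for all $n\ge 5$; \item $\mathcal{R}(\mathrm{Knight}_{4,n})=2$ for $n\in\{1,2,3\}$, and $\mathcal{R}(\mathrm{Knight}_{4,n})\ge 3$ for all $n\ge 4$. \end{itemize}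
   Context: All graphs are finite, simple and undirected. Two distinct letters $x,y$ alternate in a word $w$ if deleting from $w$ all letters other than $x$ and $y$ leaves a word of the form $xyxy\cdots$ or $yxyx\cdots$ (of even or odd length). A word $w$ over the alphabet $V$, in which every letter of $V$ occurs, represents a graph $G=(V,E)$ if for all distinct $x,y\in V$: $x$ and $y$ alternate in $w$ if and only if $(x,y)\in E$. $G$ is word-representable if some word represents it. $G$ is $k$-representable if it is represented by a word in which each letter appears exactly $k$ times. The representation number $\mathcal{R}(G)$ is the smallest integer $k\ge 1$ such that $G$ is $k$-representable; $\mathcal{R}(G)=\infty$ if $G$ is not word-representable. (Every word-representable graph is $k$-representable for some $k$.) The knight graph $\mathrm{Knight}_{m,n}$ has vertex set $\{x_{i,j}: 1\le i\le m,\ 1\le j\le n\}$, and two vertices $x_{a,b}$, $x_{c,d}$ are adjacent if and only if $\{|a-c|,|b-d|\}=\{1,2\}$. *)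

(* Defs.v *)
From mathcomp Require Import all_boot ssrint.
From mathcomp Require Import boolp.

Set Implicit Arguments.
Unset Strict Implicit.
Unset Printing Implicit Defensive.

Record sgraph := SGraph {
  vertex :> finType;
  adj : rel vertex;
  adj_sym : symmetric adj;
  adj_irr : irreflexive adj }.

(* the word x y x y ... of length k *)
Definition altword (T : Type) (x y : T) (k : nat) : seq T :=
  mkseq (fun i => if odd i then y else x) k.

Definition alternate (T : eqType) (x y : T) (w : seq T) : bool :=
  let u := [seq z <- w | (z == x) || (z == y)] in
  (u == altword x y (size u)) || (u == altword y x (size u)).

Definition represents (G : sgraph) (w : seq G) : Prop :=
  (forall x : G, x \in w) /\
  (forall x y : G, x != y -> (alternate x y w <-> adj x y)).

Definition word_representable (G : sgraph) : Prop :=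
  exists w : seq G, represents w.

Definition k_representable (k : nat) (G : sgraph) : Prop :=
  exists2 w : seq G, represents w & forall x : G, count_mem x w = k.

(* Values lie in the positive integers extended by infinity, encoded as None.
   A word-representable graph is k-representable for some k >= 1 (Kitaev and
   Pyatkin), so None is the value exactly on the graphs that are not
   word-representable; repnum_infty is the direction that is immediate. *)
Definition repnum (G : sgraph) : option nat :=
  match pselect (exists k, (0 < k) && `[< k_representable k G >]) with
  | left exk => Some (ex_minn exk)
  | right _ => None
  end.

Lemma repnum_infty (G : sgraph) : ~ word_representable G -> repnum G = None.
Proof.
rewrite /repnum => nG; case: pselect => // exk; exfalso; apply: nG.
by case: exk => k /andP[_ /asboolP[w wG _]]; exists w.
Qed.

Definition repnum_finite (G : sgraph) : Prop := exists k, repnum G = Some k.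

Definition repnum_ge (G : sgraph) (k : nat) : bool :=
  if repnum G is Some r then k <= r else true.

(* The differences below are taken in int (no truncation), then absolute values. *)
Definition knight_adj (m n : nat) : rel ('I_m * 'I_n) := fun u v =>
  let dr := `|u.1 - v.1|%N in
  let dc := `|u.2 - v.2|%N in
  ((dr == 1) && (dc == 2)) || ((dr == 2) && (dc == 1)).

Lemma knight_sym (m n : nat) : symmetric (@knight_adj m n).
Proof. by move=> u v; rewrite /knight_adj !(distnC u.1) !(distnC u.2). Qed.

Lemma knight_irr (m n : nat) : irreflexive (@knight_adj m n).
Proof. by move=> u; rewrite /knight_adj !distnn. Qed.

(* Rows and columns are numbered from 0; adjacency only sees differences. *)
Definition Knight (m n : nat) : sgraph :=
  SGraph (@knight_sym m n) (@knight_irr m n).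

(* Main.v *)
Require Import Defs.
From mathcomp Require Import all_boot.
From mathcomp Require Import ssrint boolp zify.

Set Implicit Arguments.
Unset Strict Implicit.
Unset Printing Implicit Defensive.

(** Knight graphs are bipartite, and a bipartite graph is the comparability graph
    of a poset of height 2; concatenating enough linear extensions of that poset
    gives a uniform word that represents it. A 2-uniform word is the same thing
    as a chord diagram, so the values 2 come from explicit chord diagrams: the
    2 x n board is a union of four paths, and the 3 x 4 board has one diagram
    found by search. For the lower bounds, the 2-uniform words that represent a
    fixed small induced subgraph are enumerated letter by letter, up to cyclic
    shift; on suitable subgraphs of the 3 x 5 and 4 x 4 boards none survives. *)

(** * Alternation under deletion, cyclic shift and renaming of letters *)

Section Alternation.
Variable T : eqType.
Implicit Types (x y v : T) (w : seq T).

Lemma alternate_filter (p : pred T) x y w :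
  p x -> p y -> alternate x y (filter p w) = alternate x y w.
Proof.
move=> px py; rewrite /alternate -filter_predI.
rewrite (eq_filter (a2 := fun z => (z == x) || (z == y))) // => z /=.
by case: eqP => [->|_]; [rewrite px | case: eqP => [->|]; rewrite ?py].
Qed.

Lemma perm_restrict x y w k : x != y -> count_mem x w = k -> count_mem y w = k ->
  perm_eq [seq z <- w | (z == x) || (z == y)] (nseq k x ++ nseq k y).
Proof.
move=> nxy cx cy; apply/allP => z _ /=.
rewrite count_filter count_cat !count_nseq /= ![_ == z]eq_sym.
have [->|nzx] := eqVneq z x.
  rewrite (negbTE nxy) mul1n addn0 -cx; apply/eqP/eq_count => t /=.
  by case: eqP.
have [->|nzy] := eqVneq z y.
  rewrite mul1n -cy; apply/eqP/eq_count => t /=.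
  by case: (t == y); rewrite ?orbT ?andbT ?andbF.
rewrite !mul0n addn0; apply/eqP; rewrite -(count_pred0 w); apply: eq_count => t /=.
by case: eqP => // ->; rewrite (negbTE nzx) (negbTE nzy).
Qed.

Lemma restrict_pair x y w : x != y -> count_mem x w = 1 -> count_mem y w = 1 ->
  let u := [seq z <- w | (z == x) || (z == y)] in
  u = [:: x; y] \/ u = [:: y; x].
Proof.
move=> nxy cx cy /=; have := perm_restrict nxy cx cy; rewrite /=.
case: (filter _ _) => [|a [|b [|c t]]] P; do ?by have := perm_size P.
have := perm_mem P a; rewrite !inE eqxx /= => /esym/orP[]/eqP E; move: P.
  by rewrite E perm_cons => /perm_small_eq -> //; left.
rewrite E => /perm_trans/(_ (permEl (perm_catC [:: x] [:: y]))) /=.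
by rewrite perm_cons => /perm_small_eq -> //; right.
Qed.

(* Cyclic shifts preserve alternation because the restricted word has even length. *)
Lemma alternate_rot x y w i : x != y -> count_mem x w = 2 -> count_mem y w = 2 ->
  alternate x y (rot i w) = alternate x y w.
Proof.
move=> nxy cx cy; rewrite /alternate -[in RHS](cat_take_drop i w) /rot !filter_cat.
have := perm_size (perm_restrict nxy cx cy).
rewrite -{1}(cat_take_drop i w) filter_cat size_cat /=.
move: (filter _ (take i w)) (filter _ (drop i w)) => a b.
(* The restricted word has length 4, so splitting on the lengths of its two factors leaves equations
   between single letters. *)
case: a => [|a0 [|a1 [|a2 [|a3 []]]]]; case: b => [|b0 [|b1 [|b2 [|b3 []]]]] //= _;
  rewrite /altword /= !eqseq_cons ?andbT;
  do ![by []|case: eqVneq => ?]; subst.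
all: by rewrite ?eqxx ?andbF.
Qed.
End Alternation.

Lemma alternate_map (T S : eqType) (f : T -> S) (x y : T) (w : seq T) :
  injective f -> alternate (f x) (f y) (map f w) = alternate x y w.
Proof.
move=> If; rewrite /alternate filter_map size_map.
rewrite (eq_filter (a2 := fun z => (z == x) || (z == y))); last first.
  by move=> z /=; rewrite !inj_eq.
have E a b k : altword (f a) (f b) k = map f (altword a b k).
  by rewrite /altword /mkseq -map_comp; apply: eq_map => i /=; case: odd.
by rewrite !E !(inj_eq (inj_map If)).
Qed.

(** * Criteria for the representation number *)

Lemma repnumP (G : sgraph) (k : nat) : 0 < k -> k_representable k G ->
  (forall j, 0 < j -> k_representable j G -> k <= j) -> repnum G = Some k.
Proof.
move=> k0 Gk kmin; rewrite /repnum; case: pselect => [exk|[]]; last first.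
  by exists k; rewrite k0; apply/asboolP.
case: ex_minnP => j /andP[j0 /asboolP Gj] jmin; congr Some.
by apply/eqP; rewrite eqn_leq kmin // jmin // k0; apply/asboolP.
Qed.

Lemma repnum_finiteP (G : sgraph) (k : nat) :
  0 < k -> k_representable k G -> repnum_finite G.
Proof.
move=> k0 Gk; rewrite /repnum_finite /repnum; case: pselect => [exk|[]].
  by exists (ex_minn exk).
by exists k; rewrite k0; apply/asboolP.
Qed.

(** Two letters that occur once each always alternate, so only complete graphs are 1-representable;
    a nonadjacent pair thus excludes the value 1. *)
Lemma one_representable_adj (G : sgraph) (x y : G) :
  k_representable 1 G -> x != y -> adj x y.
Proof.
move=> [w [_ wG] w1] nxy; apply/wG => //; rewrite /alternate.
by have [->|->] := restrict_pair nxy (w1 x) (w1 y); rewrite /altword /= !eqxx ?orbT.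
Qed.

Lemma repnum_eq2 (G : sgraph) (x y : G) :
  x != y -> ~~ adj x y -> k_representable 2 G -> repnum G = Some 2.
Proof.
move=> nxy nadj G2; apply: repnumP => // -[|[|j]] // _ G1.
by move: nadj; rewrite one_representable_adj.
Qed.

Lemma repnum_ge3 (G : sgraph) (x y : G) :
  x != y -> ~~ adj x y -> ~ k_representable 2 G -> repnum_ge G 3.
Proof.
move=> nxy nadj G2; rewrite /repnum_ge /repnum.
case: pselect => // exk; case: ex_minnP => -[|[|[|j]]] // /andP[_ /asboolP G1] _ //.
by move: nadj; rewrite one_representable_adj.
Qed.

(** * Uniform words for bipartite graphs *)

Section Bipartite.
Variables (G : sgraph) (c : G -> bool).
Hypothesis adj_c : forall x y : G, adj x y -> c x != c y.

Let down (u x : G) := (x == u) || (c u && adj u x).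
(** The factor 2 lets membership in the down-set dominate; the colour then puts minimal elements
    before maximal ones. *)
Let key (u x : G) := 2 * ~~ down u x + c x.
Let keyle u := relpre (key u) leq.
Let block (u : G) := sort (keyle u) (enum G).

Let keyle_total u : total (keyle u).
Proof. by move=> x y; apply: leq_total. Qed.

Let keyle_trans u : transitive (keyle u).
Proof. by move=> x y z; apply: leq_trans. Qed.

Let count_block u x : count_mem x (block u) = 1.
Proof.
by rewrite (permP (permEl (perm_sort _ _))) count_uniq_mem ?enum_uniq // mem_enum.
Qed.

Let restrict (x y : G) (w : seq G) := [seq z <- w | (z == x) || (z == y)].

Let block_pair x y u : x != y ->
  restrict x y (block u) = [:: x; y] \/ restrict x y (block u) = [:: y; x].
Proof. by move=> nxy; apply: restrict_pair. Qed.

Let block_lt x y u : x != y -> key u x < key u y ->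
  restrict x y (block u) = [:: x; y].
Proof.
move=> nxy lxy; have [//|E] := block_pair u nxy.
have := sorted_filter (keyle_trans (u := u)) (fun z => (z == x) || (z == y))
  (sort_sorted (keyle_total u) (enum G)).
by rewrite -/(block u) -/(restrict x y (block u)) E /= /keyle /= leqNgt lxy.
Qed.

(** Blocks of length 2 preserve the parity of positions, so the pattern can be checked block by
    block. *)
Let altword_flatten (x y : G) ss : all (fun s => size s == 2) ss ->
  (flatten ss == altword x y (size (flatten ss))) = all (pred1 [:: x; y]) ss.
Proof.
elim: ss => //= -[|a [|b []]] //= ss IH /IH <-.
rewrite /altword /mkseq /= (iotaDl 2 0) -map_comp.
rewrite (eq_map (g := fun i => if odd i then y else x)); last first.
  by move=> i /=; rewrite negbK.
by rewrite !eqseq_cons andbT -andbA.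
Qed.

(** Since [c y] holds, [y] is in the down-set of [u] only if [u = y], and then its neighbour [x] is
    there too; otherwise the colour decides in favour of [x]. *)
Let adj_block x y u : adj x y -> ~~ c x -> restrict x y (block u) = [:: x; y].
Proof.
move=> axy ncx; have nxy : x != y by apply: contraTneq axy => ->; rewrite adj_irr.
have cy : c y by have := adj_c axy; rewrite (negbTE ncx) eq_sym eqbF_neg negbK.
apply: block_lt => //; rewrite /key cy (negbTE ncx) addn0 addn1 ltnS leq_mul2l /=.
suff: down u y -> down u x by case: (down u y) => [->|_] //; case: (down u x).
rewrite /down => /orP[/eqP<-|/andP[cu /adj_c]]; last by rewrite cu cy.
by rewrite cy adj_sym axy orbT.
Qed.

(* Orient the edges from [~~ c] to [c]: the blocks are linear extensions of the
   resulting poset of height 2, and the block of [u] lists the down-set of [u]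
   before everything else. *)
Lemma bipartite_uniform_word : k_representable #|G| G.
Proof.
pose w := flatten [seq block u | u <- enum G].
have wcount x : count_mem x w = #|G|.
  rewrite /w count_flatten -map_comp (eq_map (g := fun=> 1)).
    by rewrite cardE; elim: (enum G) => //= a s ->.
  by move=> u; apply: count_block.
have walt x y : x != y -> alternate x y w =
    all (pred1 [:: x; y]) [seq restrict x y (block u) | u <- enum G]
    || all (pred1 [:: y; x]) [seq restrict x y (block u) | u <- enum G].
  move=> nxy; rewrite /alternate /w filter_flatten -map_comp.
  rewrite !altword_flatten //; apply/allP => s /mapP[u _ ->] /=;
    by have [E|E] := block_pair u nxy; rewrite /restrict in E; rewrite E.
exists w => //; split=> [x|x y nxy].
  by rewrite -has_pred1 has_count wcount; apply/card_gt0P; exists x.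
rewrite walt //; split=> [|axy].
  (* The block of each vertex puts that vertex before the other one, so these two blocks order a
     nonadjacent pair in opposite ways. *)
  apply: contraTT => naxy.
  have bx : restrict x y (block x) = [:: x; y].
    apply: block_lt; rewrite // /key /down eqxx eq_sym (negbTE nxy) (negbTE naxy).
    by rewrite andbF muln0 muln1 /=; case: (c x).
  have by_ : restrict x y (block y) = [:: y; x].
    rewrite /restrict (eq_filter (a2 := fun z => (z == y) || (z == x))).
      apply: block_lt; rewrite 1?eq_sym // /key /down eqxx (negbTE nxy) adj_sym.
      by rewrite (negbTE naxy) andbF muln0 muln1 /=; case: (c y).
    by move=> z; rewrite orbC.
  rewrite negb_or -!has_predC; apply/andP; split; apply/hasP.
    exists (restrict x y (block y)); first by apply/mapP; exists y; rewrite ?mem_enum.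
    by rewrite by_ /= eqseq_cons eq_sym (negbTE nxy).
  exists (restrict x y (block x)); first by apply/mapP; exists x; rewrite ?mem_enum.
  by rewrite bx /= eqseq_cons (negbTE nxy).
have [cx|ncx] := boolP (c x); last first.
  by apply/orP; left; apply/allP => s /mapP[u _ ->]; rewrite /= adj_block.
apply/orP; right; apply/allP => s /mapP[u _ ->] /=.
rewrite /restrict (eq_filter (a2 := fun z => (z == y) || (z == x))).
  rewrite -/(restrict y x (block u)) adj_block ?eqxx // 1?adj_sym //.
  by have := adj_c axy; rewrite cx; case: (c y).
by move=> z; rewrite orbC.
Qed.
End Bipartite.

(** * Chord diagrams and 2-uniform words *)

Definition cross (l1 r1 l2 r2 : nat) : bool :=
  [&& l1 < l2, l2 < r1 & r1 < r2] || [&& l2 < l1, l1 < r2 & r2 < r1].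

Section ChordModel.
Variables (G : sgraph) (l r : G -> nat).
Hypothesis uniq_lr : forall x y, x != y -> uniq [:: l x; r x; l y; r y].
Hypothesis lt_lr : forall x, l x < r x.
Hypothesis cross_adj : forall x y, x != y -> cross (l x) (r x) (l y) (r y) = adj x y.

Let at_point (i : nat) : option G := [pick x | (l x == i) || (r x == i)].

Let at_pointE x i : (l x == i) || (r x == i) -> at_point i = Some x.
Proof.
rewrite /at_point => xi; case: pickP => [y yi|/(_ x)]; last by rewrite xi.
congr Some; apply: contraTeq xi => nyx.
move: yi (uniq_lr nyx); rewrite /= !inE.
by case/orP=> /eqP<-; rewrite !negb_or; lia.
Qed.

Let N := \max_(x : G) (r x).+1.

Let lt_N x : r x < N.
Proof. exact: (leq_bigmax x). Qed.

(** Endpoints need not be consecutive: points that carry no chord give [None] and are dropped. *)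
Let w := pmap at_point (iota 0 N).

(** A strictly increasing list is determined by its members, so [s] is the list of points below [N]
    whose letter satisfies [p]. *)
Let restrict_w (s : seq nat) (p : pred G) : sorted ltn s ->
  (forall i, (i \in s) = (i < N) && oapp p false (at_point i)) ->
  filter p w = pmap at_point s.
Proof.
move=> s_sorted sP; rewrite /w.
have -> : s = filter (fun i => oapp p false (at_point i)) (iota 0 N).
  apply: (irr_sorted_eq ltn_trans ltnn) => // [|i].
    by apply: (sorted_filter ltn_trans); apply: iota_ltn_sorted.
  by rewrite sP mem_filter mem_iota andbC.
elim: (iota 0 N) => //= i t IH.
by case E: (at_point i) => [x|] //=; case: (p x); rewrite /= ?E /= IH.
Qed.

Let mem_points x i : at_point i = Some x -> (i == l x) || (i == r x).
Proof.
by rewrite /at_point; case: pickP => // y yi [<-]; rewrite ![i == _]eq_sym.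
Qed.

Let at_l x : at_point (l x) = Some x.
Proof. by apply: at_pointE; rewrite eqxx. Qed.

Let at_r x : at_point (r x) = Some x.
Proof. by apply: at_pointE; rewrite eqxx orbT. Qed.

Let l_lt_N x : l x < N.
Proof. exact: ltn_trans (lt_lr x) (lt_N x). Qed.

Let restrict1 x : filter (pred1 x) w = [:: x; x].
Proof.
rewrite (restrict_w (s := [:: l x; r x])) /= ?lt_lr ?at_l ?at_r //= => i.
rewrite !inE; apply/idP/andP => [/orP[]/eqP->|[_]].
- by rewrite at_l /= eqxx.
- by rewrite at_r /= eqxx.
by case E: (at_point i) => [y|] //= /eqP yx; rewrite -yx mem_points.
Qed.

Let restrict2 x y s : x != y -> sorted ltn s ->
  s =i [:: l x; r x; l y; r y] ->
  [seq z <- w | (z == x) || (z == y)] = pmap at_point s.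
Proof.
move=> nxy ss sE; apply: restrict_w => // i; rewrite sE !inE.
apply/idP/andP => [/or4P[]/eqP->|[_]].
- by rewrite at_l /= eqxx.
- by rewrite at_r /= eqxx.
- by rewrite at_l /= eqxx orbT.
- by rewrite at_r /= eqxx orbT.
case E: (at_point i) => [z|] //= /orP[] /eqP zE; move: (mem_points E); rewrite zE.
  by case/orP=> ->; rewrite ?orbT.
by case/orP=> ->; rewrite ?orbT.
Qed.

Lemma chord_model_2_representable : k_representable 2 G.
Proof.
have wcount x : count_mem x w = 2 by rewrite -size_filter restrict1.
exists w => //; split=> [x|x y nxy].
  by rewrite -has_pred1 has_count wcount.
rewrite -cross_adj //; apply: iff_sym; rewrite /alternate.
have := uniq_lr nxy; rewrite /= !inE => uxy.
have [lx ly] := (lt_lr x, lt_lr y).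
(* The six orders of the endpoints: two crossing, two disjoint, two nested. *)
have : sorted ltn [:: l x; l y; r x; r y] \/ sorted ltn [:: l y; l x; r y; r x] \/
       sorted ltn [:: l x; r x; l y; r y] \/ sorted ltn [:: l y; r y; l x; r x] \/
       sorted ltn [:: l x; l y; r y; r x] \/ sorted ltn [:: l y; l x; r x; r y].
  by rewrite /=; lia.
have nyx := nxy; rewrite eq_sym in nyx.
case=> [|[|[|[|[|]]]]] s_sorted; rewrite (restrict2 nxy s_sorted) /= ?at_l ?at_r;
  try by move=> i; rewrite !inE; case: (i == l x); case: (i == r x);
         case: (i == l y); case: (i == r y).
all: rewrite /= /altword /= !eqseq_cons !eqxx (negbTE nxy) (negbTE nyx) /=.
all: by move: s_sorted; rewrite /cross /=; lia.
Qed.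
End ChordModel.

(** * Enumeration of 2-uniform words *)

Section Enumeration.
Variable T : eqType.
Implicit Types (v : T) (w s : seq T).

(** All ways to insert [k] copies of [v]; the nested fixpoints recurse on the remaining copies and
    on the word. *)
Fixpoint insert v (k : nat) : seq T -> seq (seq T) :=
  if k is k'.+1 then
    fix ins w := map (cons v) (insert v k' w) ++
      (if w is a :: w' then map (cons a) (ins w') else [::])
  else fun w => [:: w].

Lemma mem_insert v w : w \in insert v (count_mem v w) (filter (predC1 v) w).
Proof.
elim: w => [|a w IH] //=.
have [->|nav] /= := eqVneq a v.
  rewrite add0n; case: (filter _ w) IH => [|b t] IH;
    by rewrite mem_cat map_f.
rewrite add0n; case: (count_mem v w) IH => [|k] IH /=.
  by move: IH; rewrite !inE => /eqP<-.
by rewrite mem_cat (map_f (cons a)) ?orbT.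
Qed.

Arguments insert : simpl never.

Variables (e : rel T) (v0 : T).

(* Only words that start with [v0] are kept, which a cyclic shift can arrange. *)
Fixpoint two_words s : seq (seq T) :=
  if s is v :: s' then
    [seq w <- flatten [seq map (cons v0) (insert v 2 (behead w)) | w <- two_words s'] |
       all (fun u => alternate u v w == e u v) (rcons s' v0)]
  else [:: [:: v0; v0]].

(** Deleting letters does not affect the alternation of the others, so the restrictions of a
    representing word pass the filter at every stage. *)
Lemma mem_two_words s w : uniq (v0 :: s) -> ohead w = Some v0 ->
    {in v0 :: s, forall x, count_mem x w = 2} ->
    {in v0 :: s &, forall x y, x != y -> alternate x y w = e x y} ->
  filter [in v0 :: s] w \in two_words s.
Proof.
case: w => // _ w + [->]; elim: s => [|v s IH] us wcount we.
  have c2 := wcount v0 (mem_head _ _).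
  rewrite (eq_filter (a2 := pred1 v0)) => [|x]; last by rewrite /= !inE.
  have /all_pred1P-> := filter_all (pred1 v0) (v0 :: w).
  by rewrite size_filter c2 inE.
have vs : {subset v0 :: s <= v0 :: v :: s}.
  by move=> x; rewrite !inE => /orP[]->; rewrite ?orbT.
have := us; rewrite [uniq _]/= inE negb_or => /and3P[/andP[nv0 v0s] nvs {}us].
have {}IH : filter [in v0 :: s] (v0 :: w) \in two_words s.
  apply: IH; first by rewrite /= v0s.
    by move=> x /vs; apply: wcount.
  by move=> x y /vs xs /vs; apply: we.
rewrite mem_filter; apply/andP; split.
  apply/allP => u; rewrite mem_rcons => us'; apply/eqP.
  have u' := vs _ us'; have v' : v \in v0 :: v :: s by rewrite !inE eqxx orbT.
  rewrite alternate_filter // we //; apply: contraTneq us' => ->.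
  by rewrite inE eq_sym (negbTE nv0).
apply/flatten_mapP; exists (filter [in v0 :: s] (v0 :: w)) => //.
rewrite /= !mem_head; apply: map_f.
(* The leading [v0] stays in place, so both copies of [v] are inserted into the tail. *)
have := mem_insert v (filter [in v0 :: v :: s] w).
rewrite -filter_predI count_filter.
rewrite (eq_count (a2 := pred1 v)); last first.
  by move=> x /=; case: eqP => // ->; rewrite !inE eqxx orbT.
have := wcount v; rewrite !inE eqxx orbT /= (negbTE nv0) add0n => ->//.
rewrite (eq_filter (a1 := predI _ _) (a2 := [in v0 :: s])) // => x /=.
rewrite !inE; case: eqP => // ->.
by rewrite eq_sym (negbTE nv0) (negbTE nvs).
Qed.

End Enumeration.

(** The map [f] renames vertices to data on which the enumeration computes. A representing word,
    rotated to start with the preimage of [v0], would yield a member of the empty list. *)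
Lemma not_2_representable (G : sgraph) (T : eqType) (f : G -> T) (e : rel T)
    (v0 : T) (s : seq T) :
  injective f -> (forall x y, adj x y = e (f x) (f y)) ->
  {in v0 :: s, forall v, exists x, f x = v} -> uniq (v0 :: s) ->
  two_words e v0 s = [::] -> ~ k_representable 2 G.
Proof.
move=> If ef sf us s0 [w [_ wG] w2].
have [x0 fx0] := sf v0 (mem_head _ _).
have /rot_to[i t wt] : x0 \in w by rewrite -has_pred1 has_count w2.
suff: filter [in v0 :: s] (map f (rot i w)) \in two_words e v0 s by rewrite s0.
apply: mem_two_words => // [|x /sf[x' <-]|x y /sf[x' <-] /sf[y' <-]].
- by rewrite wt /= fx0.
- rewrite count_map (eq_count (a2 := pred1 x')); last by move=> z /=; rewrite inj_eq.
  by rewrite (permP (permEl (perm_rot i w))) w2.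
rewrite inj_eq // => nxy; rewrite alternate_map // alternate_rot // -ef.
by apply/idP/idP => /(wG _ _ nxy).
Qed.

(** * Knight graphs in natural number coordinates *)

Definition dist (a b : nat) := (a - b) + (b - a).

Definition knight_move (u v : nat * nat) : bool :=
  let dr := dist u.1 v.1 in
  let dc := dist u.2 v.2 in
  ((dr == 1) && (dc == 2)) || ((dr == 2) && (dc == 1)).

Definition coords (m n : nat) (u : Knight m n) : nat * nat := (val u.1, val u.2).

Lemma coords_inj m n : injective (@coords m n).
Proof. by move=> [a b] [c d] [/val_inj-> /val_inj->]. Qed.

Lemma adj_coords m n (u v : Knight m n) :
  adj u v = knight_move (coords u) (coords v).
Proof.
have E (a b : nat) : `|a - b|%N = dist a b by rewrite /dist; lia.
by rewrite /= /knight_adj /knight_move /= !E.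
Qed.

Lemma coords_surj m n v : v.1 < m -> v.2 < n -> exists u : Knight m n, coords u = v.
Proof. by case: v => i j im jn; exists (Ordinal im, Ordinal jn). Qed.

(** Two squares that share a side are never a knight move apart. *)
Lemma nonadjacent m n : 0 < m -> 0 < n -> 2 < m + n ->
  exists x y : Knight m n, x != y /\ ~~ adj x y.
Proof.
move=> m0 n0 mn.
have [x xE] := @coords_surj m n (0, 0) m0 n0.
have [m1|m1] := ltnP 1 m.
  have [y yE] := @coords_surj m n (1, 0) m1 n0.
  by exists x, y; rewrite adj_coords -(inj_eq (@coords_inj m n)) xE yE.
have n1 : 1 < n by lia.
have [y yE] := @coords_surj m n (0, 1) m0 n1.
by exists x, y; rewrite adj_coords -(inj_eq (@coords_inj m n)) xE yE.
Qed.

Lemma knight_repnum_ge3 m n v0 s : 0 < m -> 0 < n -> 2 < m + n ->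
  all (fun v => (v.1 < m) && (v.2 < n)) (v0 :: s) -> uniq (v0 :: s) ->
  two_words knight_move v0 s = [::] -> repnum_ge (Knight m n) 3.
Proof.
move=> m0 n0 mn vs us s0; have [x [y [nxy nadj]]] := nonadjacent m0 n0 mn.
apply: repnum_ge3 nxy nadj _; apply: not_2_representable us s0.
- exact: coords_inj.
- exact: adj_coords.
by move=> v /(allP vs)/andP[]; apply: coords_surj.
Qed.

Lemma knight_repnum_eq2 m n (l r : nat * nat -> nat) :
  0 < m -> 0 < n -> 2 < m + n ->
  (forall u v, u.1 < m -> u.2 < n -> v.1 < m -> v.2 < n ->
     (l u < r u) && ((u != v) ==> uniq [:: l u; r u; l v; r v] &&
       (cross (l u) (r u) (l v) (r v) == knight_move u v))) ->
  repnum (Knight m n) = Some 2.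
Proof.
move=> m0 n0 mn lr; have [x [y [nxy nadj]]] := nonadjacent m0 n0 mn.
apply: repnum_eq2 nxy nadj _.
have {}lr (u v : Knight m n) := lr (coords u) (coords v)
  (ltn_ord u.1) (ltn_ord u.2) (ltn_ord v.1) (ltn_ord v.2).
apply: (@chord_model_2_representable _ (l \o @coords m n) (r \o @coords m n))
  => [u v nuv|u|u v nuv].
- by have /andP[_] := lr u v; rewrite (inj_eq (@coords_inj m n)) nuv => /andP[].
- by have /andP[] := lr u u.
have /andP[_] := lr u v; rewrite (inj_eq (@coords_inj m n)) nuv.
by rewrite adj_coords => /andP[_ /eqP].
Qed.

(** * Representation numbers of knight graphs *)

Lemma knight_finite m n : 0 < m -> 0 < n -> repnum_finite (Knight m n).
Proof.
move=> m0 n0; apply: (@repnum_finiteP _ #|Knight m n|).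
  by rewrite card_prod !card_ord muln_gt0 m0.
(* The chessboard colouring: a knight move changes the sum of the coordinates by an odd number. *)
apply: (@bipartite_uniform_word (Knight m n) (fun u => odd (u.1 + u.2))) => u v.
by rewrite adj_coords /knight_move /coords /dist /=; lia.
Qed.

Lemma knight11 : repnum (Knight 1 1) = Some 1.
Proof.
apply: repnumP => //; pose o : Knight 1 1 := (ord0, ord0).
have eo (x : Knight 1 1) : x = o by case: x => a b; rewrite !ord1.
exists [:: o] => [|x]; last by rewrite /= (eo x) eqxx.
by split=> [x|x y]; rewrite (eo x) ?mem_head // (eo y) eqxx.
Qed.

Lemma knight_row_repnum n : 2 <= n -> repnum (Knight 1 n) = Some 2.
Proof.
(* A single row has no knight moves, so disjoint chords suffice. *)
move=> n2; apply: (@knight_repnum_eq2 _ _ (fun u => u.2.*2) (fun u => u.2.*2.+1));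
  rewrite //; try by lia.
move=> [a b] [c d] /= a0 _ c0 _; rewrite xpair_eqE.
by rewrite /knight_move /cross /dist /= !inE; lia.
Qed.

(* Knight moves on a board with 2 rows join consecutive squares of four paths,
   which are laid out one after the other with gaps. *)
Definition path_position (n : nat) (u : nat * nat) : nat :=
  u.2./2 + n.+1 * (2 * odd u.2 + odd (u.1 + u.2./2)).

Lemma knight_2_repnum n : 1 <= n -> repnum (Knight 2 n) = Some 2.
Proof.
move=> n1.
(* Chords of length 3 with even left endpoints cross exactly when these differ by 2, that is, for
   consecutive positions. *)
apply: (@knight_repnum_eq2 _ _ (fun u => (path_position n u).*2)
          (fun u => (path_position n u).*2 + 3));
  rewrite //; try by lia.
move=> u v u1 u2 v1 v2.
suff [E1 E2] : (path_position n u == path_position n v) = (u == v) /\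
    (dist (path_position n u) (path_position n v) == 1) = knight_move u v.
  rewrite -E2 -E1 /cross /dist /= !inE.
  move: (path_position n u) (path_position n v) => a b; lia.
move: u v u1 u2 v1 v2 => [a b] [c d] /= a2 bn c2 dn; rewrite xpair_eqE.
rewrite /path_position /knight_move /dist /=.
move: a2 c2; case: a => [|[|a]] //; case: c => [|[|c]] // _ _;
rewrite ?add0n ?add1n /=;
(* The path of a square depends on its row and on the two lowest bits of its column, so the proof
   splits on these bits. *)
have := odd_double_half b; have := odd_double_half d;
have := odd_double_half b./2; have := odd_double_half d./2;
case: (odd b); case: (odd d); case: (odd b./2); case: (odd d./2) => /=; nia.
Qed.

Definition word_3_4 : seq (nat * nat) :=
  [:: (0, 0); (1, 3); (0, 2); (2, 1); (1, 0); (2, 3); (0, 2); (1, 1);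
      (2, 3); (0, 3); (1, 1); (2, 2); (0, 3); (1, 0); (0, 1); (2, 2);
      (1, 3); (2, 0); (0, 1); (1, 2); (2, 0); (0, 0); (1, 2); (2, 1)].

Definition first_3_4 u := index u word_3_4.
Definition last_3_4 u := (size word_3_4).-1 - index u (rev word_3_4).

Lemma chords_3_4 u v : u.1 < 3 -> u.2 < 4 -> v.1 < 3 -> v.2 < 4 ->
  (first_3_4 u < last_3_4 u) &&
  ((u != v) ==> uniq [:: first_3_4 u; last_3_4 u; first_3_4 v; last_3_4 v] &&
    (cross (first_3_4 u) (last_3_4 u) (first_3_4 v) (last_3_4 v)
       == knight_move u v)).
Proof.
(* Listing the 12 squares turns the claim into a finite check by computation. *)
have mem_grid (w : nat * nat) : w.1 < 3 -> w.2 < 4 ->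
    w \in [seq (i, j) | i <- iota 0 3, j <- iota 0 4].
  by case: w => i j ? ?; apply: allpairs_f; rewrite mem_iota.
move=> /mem_grid{}/[apply] uG /mem_grid{}/[apply]; move: v; apply/allP.
by move: u uG; apply/allP; vm_compute.
Qed.

(** Narrower boards are induced subgraphs of the 3 x 4 board and inherit its chords. *)
Lemma knight_3_repnum n : 1 <= n <= 4 -> repnum (Knight 3 n) = Some 2.
Proof.
case/andP=> n1 n4; apply: (knight_repnum_eq2 (l := first_3_4) (r := last_3_4)) => //.
move=> u v u1 u2 v1 v2.
by apply: chords_3_4; rewrite ?(leq_trans u2) ?(leq_trans v2).
Qed.

(** Transposition embeds these boards into the 3 x 4 board. *)
Lemma knight_4_repnum n : 1 <= n <= 3 -> repnum (Knight 4 n) = Some 2.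
Proof.
case/andP=> n1 n3; pose swap (u : nat * nat) := (u.2, u.1).
apply: (knight_repnum_eq2 (l := first_3_4 \o swap) (r := last_3_4 \o swap)) => //.
move=> u v u1 u2 v1 v2.
have -> : (u != v) = (swap u != swap v).
  by rewrite /swap -pair_eqE /= andbC; case: (u) (v) => ? ? [].
have -> : knight_move u v = knight_move (swap u) (swap v).
  by rewrite /knight_move orbC ![(_ == 2) && _]andbC.
by apply: chords_3_4; rewrite ?(leq_trans u2) ?(leq_trans v2).
Qed.

(* [two_words] inserts the letters from the last one to the first; in this order
   fewer than 20 words survive each step. *)
Definition obstruction_3_5 : seq (nat * nat) :=
  [:: (2, 2); (1, 0); (2, 3); (0, 4); (0, 2); (2, 1); (0, 0); (1, 2); (2, 0); (1, 3)].

Lemma two_words_3_5 : two_words knight_move (0, 1) obstruction_3_5 = [::].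
Proof. by apply/nilP; vm_compute. Qed.

Definition obstruction_4_4 : seq (nat * nat) :=
  [:: (3, 1); (2, 2); (1, 0); (0, 2); (2, 1); (1, 3); (0, 1); (2, 0); (1, 2)].

Lemma two_words_4_4 : two_words knight_move (0, 0) obstruction_4_4 = [::].
Proof. by apply/nilP; vm_compute. Qed.

(** The obstruction lies in the first five columns and stays induced on every wider board, as
    adjacency depends on coordinates alone. *)
Lemma knight_3_repnum_ge n : 5 <= n -> repnum_ge (Knight 3 n) 3.
Proof.
move=> n5; apply: knight_repnum_ge3 two_words_3_5 => //; first by lia.
by apply: (sub_all (a1 := fun v => (v.1 < 3) && (v.2 < 5))) => // v; lia.
Qed.

Lemma knight_4_repnum_ge n : 4 <= n -> repnum_ge (Knight 4 n) 3.
Proof.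
move=> n4; apply: knight_repnum_ge3 two_words_4_4 => //; first by lia.
by apply: (sub_all (a1 := fun v => (v.1 < 4) && (v.2 < 4))) => // v; lia.
Qed.

Theorem mainTheorem5 :
  (forall m n : nat, 1 <= m -> 1 <= n -> repnum_finite (Knight m n)) /\
  (repnum (Knight 1 1) = Some 1 /\
   (forall n : nat, 2 <= n -> repnum (Knight 1 n) = Some 2)) /\
  (forall n : nat, 1 <= n -> repnum (Knight 2 n) = Some 2) /\
  ((forall n : nat, 1 <= n <= 4 -> repnum (Knight 3 n) = Some 2) /\
   (forall n : nat, 5 <= n -> repnum_ge (Knight 3 n) 3)) /\
  ((forall n : nat, 1 <= n <= 3 -> repnum (Knight 4 n) = Some 2) /\
   (forall n : nat, 4 <= n -> repnum_ge (Knight 4 n) 3)).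
Proof.
split; first exact: knight_finite.
split; first by split; [exact: knight11 | exact: knight_row_repnum].
split; first exact: knight_2_repnum.
split; split.
- exact: knight_3_repnum.
- exact: knight_3_repnum_ge.
- exact: knight_4_repnum.
exact: knight_4_repnum_ge.
Qed.
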